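(* Let $(M,g)$ be a Riemannian manifold and let $f: M\to\mathbb{C}$ be a smooth function. Then the following conditions are equivalent: 1) $f$ is a $(\lambda,\mu)$-eigenfunction (for some $\lambda,\mu\in\mathbb{C}$); 2) the functions $f$ and $f^2$ are eigenfunctions of the operator $\tau$; 3) the functions $f^n$, for all $n\in\mathbb{N}$, are eigenfunctions of the operator $\tau$.
   Context: Extend $g$ to a complex bilinear form on the complexified tangent bundle $T^{\mathbb{C}}M$. For smooth functions $\varphi,\psi: M\to\mathbb{C}$ define the Laplace-Beltrami operator $\tau(\varphi) := \operatorname{div}\operatorname{grad}\varphi$ and the bilinear conformality operator $\varkappa(\varphi,\psi) := g(\operatorname{grad}\varphi,\operatorname{grad}\psi)$ (complex bilinear, not Hermitian). A function $f: M\to\mathbb{C}$ is called a $(\lambda,\mu)$-eigenfunction if there exist $\lambda,\mu\in\mathbb{C}$ such that $\tau(f)=\lambda f$ and $\varkappa(f,f)=\mu f^2$. A function $\varphi: M\to\mathbb{C}$ is an eigenfunction of $\tau$ if there is a constant $c\in\mathbb{C}$ with $\tau(\varphi)=c\,\varphi$ (the zero function is not excluded). $\mathbb{N}$ denotes the positive integers, and $f^n$ is the pointwise $n$-th power. *)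

(* Defs.v *)
From HB Require Import structures.
From mathcomp Require Import all_boot all_order all_algebra.
From mathcomp Require Import complex.
From mathcomp Require Import all_classical all_reals all_analysis.

Set Implicit Arguments.
Unset Strict Implicit.
Unset Printing Implicit Defensive.

Import Order.TTheory GRing.Theory Num.Theory numFieldNormedType.Exports.

Local Open Scope classical_set_scope.
Local Open Scope ring_scope.
Local Open Scope complex_scope.

Section Calculus.
Context {R : realType} {n : nat}.
Implicit Types (h : 'rV[R]_n -> R) (u : 'rV[R]_n -> R[i]) (U : set 'rV[R]_n).

Definition partial (i : 'I_n) h (y : 'rV[R]_n) : R := 'D_(delta_mx 0 i) h y.

Definition cpartial (i : 'I_n) u (y : 'rV[R]_n) : R[i] :=
  partial i (fun z => complex.Re (u z)) y +i*
  partial i (fun z => complex.Im (u z)) y.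

(* Meant for open U: differentiability and continuity are those of h itself,
   not of its restriction to U. *)
Fixpoint Ck (k : nat) U h : Prop :=
  (forall y, U y -> {for y, continuous h}) /\
  (if k is k'.+1 then
     forall i : 'I_n, (forall y, U y -> derivable h y (delta_mx 0 i)) /\
                      Ck k' U (partial i h)
   else True).

Definition smooth_on U h : Prop := forall k, Ck k U h.

End Calculus.

(* chart_fun and chart_inv are total functions whose values outside of
   chart_dom and chart_cod, respectively, are irrelevant. *)
Record chart (R : realType) (n : nat) (M : topologicalType) := Chart {
  chart_dom : set M;
  chart_cod : set 'rV[R]_n;
  chart_fun :> M -> 'rV[R]_n;
  chart_inv : 'rV[R]_n -> M;
  chart_dom_open : open chart_dom;
  chart_cod_open : open chart_cod;
  chart_funP : forall x, chart_dom x -> chart_cod (chart_fun x);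
  chart_invP : forall y, chart_cod y -> chart_dom (chart_inv y);
  chart_funK : forall x, chart_dom x -> chart_inv (chart_fun x) = x;
  chart_invK : forall y, chart_cod y -> chart_fun (chart_inv y) = y;
  chart_fun_cont : forall x, chart_dom x -> {for x, continuous chart_fun};
  chart_inv_cont : forall y, chart_cod y -> {for y, continuous chart_inv} }.

Section Transition.
Context {R : realType} {n : nat} {M : topologicalType}.
Implicit Type e : chart R n M.

Definition overlap e (e' : chart R n M) : set 'rV[R]_n :=
  [set y | chart_cod e y /\ chart_dom e' (chart_inv e y)].

Definition transition e (e' : chart R n M) (y : 'rV[R]_n) : 'rV[R]_n := e' (chart_inv e y).

Definition transition_jacobian e (e' : chart R n M) (y : 'rV[R]_n) : 'M[R]_n :=
  \matrix_(i, j) partial i (fun z => transition e e' z 0 j) y.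

End Transition.

Record smooth_manifold (R : realType) (n : nat) := SmoothManifold {
  carrier :> topologicalType;
  carrier_hausdorff : hausdorff_space carrier;
  carrier_second_countable : @second_countable carrier;
  atlas : set (chart R n carrier);
  atlas_cover : forall x : carrier, exists2 e, atlas e & chart_dom e x;
  atlas_smooth : forall e e', atlas e -> atlas e' ->
    forall j : 'I_n, smooth_on (overlap e e') (fun y => transition e e' y 0 j) }.

(* A Riemannian metric is given by its matrix (g_ij) in the coordinates of
   every chart of the atlas; metric_tensor is the transformation law of a
   covariant 2-tensor,
     g_ij = \sum_(k, l) (d y'_k / d y_i) g'_kl (d y'_l / d y_j). *)
Record riemannian_manifold (R : realType) (n : nat) := RiemannianManifold {
  manifold_of :> smooth_manifold R n;
  metric : chart R n manifold_of -> 'rV[R]_n -> 'M[R]_n;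
  metric_smooth : forall e, atlas e -> forall i j : 'I_n,
    smooth_on (chart_cod e) (fun y => metric e y i j);
  metric_sym : forall e, atlas e -> forall y, chart_cod e y ->
    (metric e y)^T = metric e y;
  metric_posdef : forall e, atlas e -> forall y, chart_cod e y ->
    forall v : 'rV[R]_n, v != 0 -> 0 < (v *m metric e y *m v^T) 0 0;
  metric_tensor : forall e e', atlas e -> atlas e' ->
    forall y, overlap e e' y ->
    metric e y = transition_jacobian e e' y *m metric e' (transition e e' y)
                 *m (transition_jacobian e e' y)^T }.

Section Operators.
Context {R : realType} {n : nat} (M : riemannian_manifold R n).
Implicit Types (phi psi : M -> R[i]) (x : M).

Definition smooth_function phi : Prop :=
  forall e, @atlas _ _ M e ->
    smooth_on (chart_cod e) (fun y => complex.Re (phi (chart_inv e y))) /\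
    smooth_on (chart_cod e) (fun y => complex.Im (phi (chart_inv e y))).

(* The objects below are invariant under changes of coordinates, so their
   value at a point may be computed in any chart around it. *)
Definition chart_at x : chart R n M := s2val (cid2 (atlas_cover x)).

(* Sections of the complexified tangent bundle: X e y is the row of the
   components of X at the point chart_inv e y, with respect to the coordinate
   frame (d/dy_i) of the chart e. *)
Definition vector_field := chart R n M -> 'rV[R]_n -> 'rV[R[i]]_n.

Definition metricC (e : chart R n M) (y : 'rV[R]_n) : 'M[R[i]]_n :=
  map_mx (fun a : R => a%:C) (metric e y).

(* complex bilinear extension of g: no conjugation *)
Definition g (X Y : vector_field) x : R[i] :=
  let e := chart_at x in let y := e x in
  (X e y *m metricC e y *m (Y e y)^T) 0 0.

(* (grad phi)^j = \sum_i (d phi / d y_i) g^ij *)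
Definition grad phi : vector_field := fun e y =>
  (\row_i cpartial i (fun z => phi (chart_inv e z)) y) *m invmx (metricC e y).

Definition volume_density (e : chart R n M) (y : 'rV[R]_n) : R :=
  Num.sqrt (\det (metric e y)).

(* div X = (1 / sqrt |g|) \sum_i d (sqrt |g| X^i) / d y_i *)
Definition div (X : vector_field) x : R[i] :=
  let e := chart_at x in let y := e x in
  ((volume_density e y)%:C)^-1 *
  \sum_(i < n) cpartial i (fun z => (volume_density e z)%:C * X e z 0 i) y.

Definition laplace_beltrami phi : M -> R[i] := div (grad phi).

Definition conformality phi psi : M -> R[i] := g (grad phi) (grad psi).

Definition lambda_mu_eigenfunction phi : Prop :=
  exists lambda mu : R[i],
    (forall x, laplace_beltrami phi x = lambda * phi x) /\
    (forall x, conformality phi phi x = mu * phi x ^+ 2).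

Definition tau_eigenfunction phi : Prop :=
  exists c : R[i], forall x, laplace_beltrami phi x = c * phi x.

End Operators.

(* Main.v *)
Require Import Defs.
From mathcomp Require Import all_boot all_order all_algebra.
From mathcomp Require Import complex.
From mathcomp Require Import all_classical all_reals all_analysis.
From mathcomp Require Import ring.

(** The equivalence holds because tau is a second order operator without zeroth
order term whose first order defect is kappa: for every k,

  tau(f^k) = k f^(k-1) tau(f) + k (k - 1) f^(k-2) kappa(f, f).

If tau(f) = lambda f and kappa(f, f) = mu f^2, the right-hand side is
(k lambda + k (k - 1) mu) f^k, so every power of f is an eigenfunction.
Conversely, the case k = 2 reads 2 kappa(f, f) = tau(f^2) - 2 f tau(f); if f
and f^2 are eigenfunctions for lambda and c, this gives
kappa(f, f) = ((c - 2 lambda) / 2) f^2.  No division by f takes place, so the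
zeros of f need no separate treatment.

The power formula is [laplace_beltrami_expr].  In a chart, on the whole open
coordinate domain, grad(f^k) = k f^(k-1) grad f ([grad_expr]); the formula then
follows by differentiating sqrt|g| grad(f^k) with the Leibniz rule, since
grad f contracted with df is kappa(f, f) ([conformalityE]).  The Leibniz rule
requires the components of the flux sqrt|g| grad f to have partial derivatives
([cderivable_flux]).  This rests on |g| > 0, which makes both the square root
and the inverse matrix differentiable, and which also allows the factors
sqrt|g| and 1/sqrt|g| to cancel; the positivity comes from that of the metric
by a homotopy argument ([positive_definite_det_gt0]). *)

Set Implicit Arguments.
Unset Strict Implicit.
Unset Printing Implicit Defensive.

Import Order.TTheory GRing.Theory Num.Theory numFieldNormedType.Exports.

Local Open Scope classical_set_scope.
Local Open Scope ring_scope.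
Local Open Scope complex_scope.

(** * Determinants of positive definite matrices *)

Section PositiveDefinite.
Context {R : rcfType} {n : nat}.
Implicit Types A B : 'M[R]_n.

Definition positive_definite A : Prop :=
  forall v : 'rV[R]_n, v != 0 -> 0 < (v *m A *m v^T) 0 0.

Lemma positive_definite_unitmx A : positive_definite A -> A \in unitmx.
Proof.
move=> Apos; rewrite -row_free_unit -kermx_eq0; apply/rowV0P => v /sub_kermxP vA.
apply/eqP; apply: contraT => /Apos.
by rewrite vA mul0mx mxE ltxx.
Qed.

Lemma positive_definite1 : positive_definite 1%:M.
Proof.
move=> v /rV0Pn[j vj]; rewrite mulmx1 mxE.
under eq_bigr do rewrite mxE -expr2.
rewrite (bigD1 j)//= ltr_pwDl ?exprn_even_gt0//.
by apply: sumr_ge0 => i _; exact: sqr_ge0.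
Qed.

Lemma positive_definite_conv A B (t : R) :
  positive_definite A -> positive_definite B -> 0 <= t <= 1 ->
  positive_definite (t *: A + (1 - t) *: B).
Proof.
move=> Apos Bpos /andP[t0 t1] v v0.
rewrite mulmxDr mulmxDl -!scalemxAr -!scalemxAl !mxE.
have [->|tn0] := eqVneq t 0.
  by rewrite mul0r add0r subr0 mul1r; have := Bpos _ v0; rewrite mxE.
have := Apos _ v0; have := Bpos _ v0; rewrite !mxE => Bv Av.
apply: ltr_pwDl; first by rewrite mulr_gt0// lt0r tn0.
by rewrite mulr_ge0 ?subr_ge0// ltW.
Qed.

(** Along the segment from A to the identity all matrices are positive definite,
hence invertible, so the determinant, a polynomial in the parameter of the
segment, has no zero there and keeps the sign that it has at the identity. *)
Lemma positive_definite_det_gt0 A : positive_definite A -> 0 < \det A.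
Proof.
move=> Apos; rewrite ltNge; apply/negP => detA.
pose P : 'M[{poly R}]_n :=
  'X *: map_mx polyC 1%:M + (1 - 'X) *: map_mx polyC A.
have PE t : (\det P).[t] = \det (t *: 1%:M + (1 - t) *: A).
  rewrite -[LHS]/(horner_eval t _) -det_map_mx; congr (\det _).
  by apply/matrixP => i j; rewrite !mxE /= /horner_eval !hornerE.
have [|t t01] := @poly_ivt R (\det P) 0 1 ler01.
  rewrite !PE !scale0r !scale1r add0r subr0 scale1r detA/=.
  by rewrite subrr scale0r addr0 det1 ler01.
rewrite /root PE => /eqP det0.
have := positive_definite_unitmx
  (positive_definite_conv positive_definite1 Apos t01).
by rewrite unitmxE det0 unitr0.
Qed.

End PositiveDefinite.

(** * Differentiability of determinants, inverse matrices and square roots *)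

Section DirectionalDerivability.
Context {R : realType} {V : normedModType R} (y v : V).
Implicit Types h : V -> R.

Lemma derivable_bigsum (I : Type) (r : seq I) (P : pred I) (h : I -> V -> R) :
  (forall i, P i -> derivable (h i) y v) ->
  derivable (fun z => \sum_(i <- r | P i) h i z) y v.
Proof.
move=> dh; rewrite -fct_sumE; apply: (big_ind (fun h => derivable h y v)).
- exact: (derivable_cst (0 : R)).
- by move=> h1 h2; exact: derivableD.
- exact: dh.
Qed.

Lemma derivable_bigprod (I : Type) (r : seq I) (P : pred I) (h : I -> V -> R) :
  (forall i, P i -> derivable (h i) y v) ->
  derivable (fun z => \prod_(i <- r | P i) h i z) y v.
Proof.
move=> dh; rewrite -fct_prodE; apply: (big_ind (fun h => derivable h y v)).
- exact: (derivable_cst (1 : R)).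
- by move=> h1 h2; exact: derivableM.
- exact: dh.
Qed.

Lemma derivable_det m (A : V -> 'M[R]_m) :
  (forall i j, derivable (fun z => A z i j) y v) ->
  derivable (fun z => \det (A z)) y v.
Proof.
move=> dA; apply: derivable_bigsum => s _.
apply: derivableM; first exact: derivable_cst.
by apply: derivable_bigprod => i _; exact: dA.
Qed.

(** Cramer's rule expresses the entries of the inverse through determinants.
It describes invmx at invertible matrices only, whence the condition on a
neighbourhood of y. *)
Lemma derivable_invmx m (A : V -> 'M[R]_m) i j :
  (forall i j, derivable (fun z => A z i j) y v) ->
  (\forall z \near y, A z \in unitmx) ->
  derivable (fun z => invmx (A z) i j) y v.
Proof.
move=> dA uA.
apply: (@near_eq_derivable _ _ _
  (fun z => (\det (A z))^-1 * cofactor (A z) j i)).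
  by near=> z; rewrite /invmx ifT ?mxE//; near: z.
have uAy : A y \in unitmx by exact: nbhs_singleton uA.
apply: derivableM.
  apply: derivableV; last exact: derivable_det.
  by rewrite -unitfE -unitmxE.
apply: derivableM; first exact: derivable_cst.
apply: derivable_det => k l.
by under eq_fun do rewrite !mxE; exact: dA.
Unshelve. all: by end_near. Qed.

Lemma derivable_sqrt h :
  0 < h y -> derivable h y v -> derivable (fun z => Num.sqrt (h z)) y v.
Proof.
move=> hy /derivable1P/derivable1_diffP dh.
(* Restricted to the line through y, this is the one-variable chain rule. *)
apply/derivable1P/derivable1_diffP.
apply: (@differentiable_comp _ _ _ _ (fun t : R => h (t *: v + y)) Num.sqrt) => //.
apply/derivable1_diffP; rewrite scale0r add0r.
by have [] := is_derive1_sqrt hy.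
Qed.

End DirectionalDerivability.

(** * Partial derivatives of complex-valued functions *)

Section ComplexPartial.
Context {R : realType} {n : nat} (i : 'I_n) (y : 'rV[R]_n).
Implicit Types (h : 'rV[R]_n -> R) (u w : 'rV[R]_n -> R[i]).

Definition cderivable u : Prop :=
  derivable (fun z => complex.Re (u z)) y (delta_mx 0 i) /\
  derivable (fun z => complex.Im (u z)) y (delta_mx 0 i).

Lemma near_eq_cpartial u w :
  {near y, u =1 w} -> cpartial i u y = cpartial i w y.
Proof.
move=> uw; congr (_ +i* _); apply: near_eq_derive;
  by apply: filterS uw => z ->.
Qed.

Lemma cderivable_real h :
  derivable h y (delta_mx 0 i) -> cderivable (fun z => (h z)%:C).
Proof. by split; last exact: (derivable_cst (0 : R)). Qed.

Lemma cderivable_cst (c : R[i]) : cderivable (fun=> c).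
Proof. by split; [exact: (derivable_cst (complex.Re c))
                 |exact: (derivable_cst (complex.Im c))]. Qed.

Lemma cpartial_cst (c : R[i]) : cpartial i (fun=> c) y = 0.
Proof. by rewrite /cpartial /partial !derive_cst. Qed.

Let Re_mulE u w : (fun z => complex.Re (u z * w z)) =
  (fun z => complex.Re (u z)) * (fun z => complex.Re (w z))
  - (fun z => complex.Im (u z)) * (fun z => complex.Im (w z)).
Proof. by apply/funext => z; rewrite !fctE; case: (u z); case: (w z). Qed.

Let Im_mulE u w : (fun z => complex.Im (u z * w z)) =
  (fun z => complex.Re (u z)) * (fun z => complex.Im (w z))
  + (fun z => complex.Im (u z)) * (fun z => complex.Re (w z)).
Proof. by apply/funext => z; rewrite !fctE; case: (u z); case: (w z). Qed.

Lemma cderivableM u w :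
  cderivable u -> cderivable w -> cderivable (fun z => u z * w z).
Proof.
move=> [du1 du2] [dw1 dw2]; rewrite /cderivable Re_mulE Im_mulE; split.
  exact: derivableB (derivableM du1 dw1) (derivableM du2 dw2).
exact: derivableD (derivableM du1 dw2) (derivableM du2 dw1).
Qed.

Lemma cpartialM u w : cderivable u -> cderivable w ->
  cpartial i (fun z => u z * w z) y = cpartial i u y * w y + u y * cpartial i w y.
Proof.
move=> [du1 du2] [dw1 dw2]; rewrite /cpartial /partial Re_mulE Im_mulE.
rewrite (deriveB (derivableM du1 dw1) (derivableM du2 dw2)).
rewrite (deriveD (derivableM du1 dw2) (derivableM du2 dw1)).
rewrite (deriveM du1 dw1) (deriveM du2 dw2) (deriveM du1 dw2) (deriveM du2 dw1).
move: ('D_ _ _ _) ('D_ _ _ _) ('D_ _ _ _) ('D_ _ _ _) => dw1' du1' du2' dw2'.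
(* What remains is an identity between the eight real numbers involved. *)
case: (u y) => a b; case: (w y) => c d.
by rewrite /GRing.scale/=; simpc; congr (_ +i* _); ring.
Qed.

Lemma cderivable_sum (I : Type) (r : seq I) (u : I -> 'rV[R]_n -> R[i]) :
  (forall j, cderivable (u j)) -> cderivable (fun z => \sum_(j <- r) u j z).
Proof.
move=> du; split.
  under eq_fun do rewrite raddf_sum/=.
  by apply: derivable_bigsum => j _; case: (du j).
under eq_fun do rewrite raddf_sum/=.
by apply: derivable_bigsum => j _; case: (du j).
Qed.

Lemma cderivableX u k : cderivable u -> cderivable (fun z => u z ^+ k).
Proof.
move=> du; elim: k => [|k ihk].
  by under eq_fun do rewrite expr0; exact: cderivable_cst.
by under eq_fun do rewrite exprS; exact: cderivableM.
Qed.

Lemma cpartialX u k : cderivable u ->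
  cpartial i (fun z => u z ^+ k) y = k%:R * u y ^+ k.-1 * cpartial i u y.
Proof.
move=> du; elim: k => [|k ihk].
  by rewrite !mul0r; under eq_fun do rewrite expr0; exact: cpartial_cst.
rewrite (_ : (fun z => _) = (fun z => u z * u z ^+ k)); last first.
  by apply/funext => z; rewrite exprS.
rewrite (cpartialM du (cderivableX k du)) ihk /=; case: k {ihk} => [|k]; first by rewrite !expr0; ring.
by rewrite /= exprS -[k.+2%:R]natr1; ring.
Qed.

End ComplexPartial.

(** * The power rule for the Laplace-Beltrami operator *)

Section Smooth.
Context {R : realType} {n : nat} (U : set 'rV[R]_n).

Lemma smooth_on_derivable (h : 'rV[R]_n -> R) y i :
  smooth_on U h -> U y -> derivable h y (delta_mx 0 i).
Proof. by move=> sh Uy; have [_ /(_ i)[+ _]] := sh 1; exact. Qed.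

Lemma smooth_on_partial (h : 'rV[R]_n -> R) i :
  smooth_on U h -> smooth_on U (partial i h).
Proof. by move=> sh k; have [_ /(_ i)[_]] := sh k.+1. Qed.

End Smooth.

Section PowerRule.
Context {R : realType} {n : nat} (M : riemannian_manifold R n).
Variables (f : M -> R[i]) (hf : smooth_function f).
Variables (e : chart R n M) (he : atlas e).
Let F z := f (chart_inv e z).

Lemma metric_det_gt0 y : chart_cod e y -> 0 < \det (metric e y).
Proof. by move=> ey; apply: positive_definite_det_gt0; exact: metric_posdef. Qed.

Lemma metric_unitmx y : chart_cod e y -> metric e y \in unitmx.
Proof. by move=> ey; rewrite unitmxE unitfE gt_eqF// metric_det_gt0. Qed.

Lemma cderivable_chart i y : chart_cod e y -> cderivable i y F.
Proof.
by move=> ey; have [sRe sIm] := hf he; split; exact: smooth_on_derivable ey.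
Qed.

(** The flux sqrt|g| grad f is the field that div differentiates.  Its first
derivatives involve second derivatives of f and first derivatives of the
metric; the latter enter through sqrt|g| and the inverse metric. *)
Lemma cderivable_flux i j y : chart_cod e y ->
  cderivable i y (fun z => (volume_density e z)%:C * grad f e z 0 j).
Proof.
move=> ey; have nbhs_cod : nbhs y (chart_cod e).
  exact: open_nbhs_nbhs (conj (@chart_cod_open _ _ _ e) ey).
have dg k l : derivable (fun z => metric e z k l) y (delta_mx 0 i).
  by apply: smooth_on_derivable ey; exact: metric_smooth.
apply: cderivableM.
  apply: cderivable_real; apply: derivable_sqrt; last exact: derivable_det.
  exact: metric_det_gt0.
rewrite (_ : (fun z => _) = (fun z => \sum_k
    cpartial k F z * (invmx (metric e z) k j)%:C)); last first.
  apply/funext => z; rewrite /grad mxE; apply: eq_bigr => k _.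
  by rewrite /metricC -map_invmx !mxE.
apply: cderivable_sum => k; apply: cderivableM.
  have [sRe sIm] := hf he.
  by split; apply: smooth_on_derivable ey; exact: smooth_on_partial.
apply: cderivable_real; apply: derivable_invmx => //.
by apply: filterS nbhs_cod => z; exact: metric_unitmx.
Qed.

(** The identity is needed at all points of the coordinate domain, not only at
one point, since div differentiates it. *)
Lemma grad_expr k y : chart_cod e y ->
  grad (fun x => f x ^+ k) e y = (k%:R * F y ^+ k.-1) *: grad f e y.
Proof.
move=> ey; rewrite /grad scalemxAl; congr (_ *m _).
apply/rowP => i; rewrite !mxE (@cpartialX _ _ i y F)//.
exact: cderivable_chart.
Qed.

End PowerRule.

Section AtPoint.
Context {R : realType} {n : nat} (M : riemannian_manifold R n).

Lemma atlas_chart_at (x : M) : atlas (chart_at x).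
Proof. by rewrite /chart_at; case: cid2. Qed.

Lemma chart_at_dom (x : M) : chart_dom (chart_at x) x.
Proof. by rewrite /chart_at; case: cid2. Qed.

(** Raising the index of d phi with the inverse metric and contracting with the
metric again cancel, so kappa(phi, psi) is d phi applied to grad psi. *)
Lemma conformalityE (phi psi : M -> R[i]) x :
  let e := chart_at x in let y := e x in
  conformality phi psi x =
  \sum_i cpartial i (fun z => phi (chart_inv e z)) y * grad psi e y 0 i.
Proof.
move=> e y; rewrite /conformality /g -/e -/y {1}/grad mulmxKV; last first.
  rewrite /metricC map_unitmx; apply: metric_unitmx.
    exact: atlas_chart_at.
  exact/chart_funP/chart_at_dom.
by rewrite mxE; apply: eq_bigr => i _; rewrite !mxE.
Qed.

(** Leibniz rule for div(k f^(k-1) grad f): differentiating the flux of f yields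
the term in tau(f), and differentiating the factor f^(k-1) yields
d f (grad f) = kappa(f, f).  The truncated predecessors are harmless: a power
with truncated exponent always comes with the coefficient 0. *)
Lemma laplace_beltrami_expr (f : M -> R[i]) k x : smooth_function f ->
  laplace_beltrami (fun x => f x ^+ k) x =
  k%:R * f x ^+ k.-1 * laplace_beltrami f x +
  (k * k.-1)%:R * f x ^+ k.-2 * conformality f f x.
Proof.
move=> hf; rewrite conformalityE /laplace_beltrami /div.
set e := chart_at x; set y := e x.
have he : atlas e by exact: atlas_chart_at.
have ey : chart_cod e y by exact/chart_funP/chart_at_dom.
have nbhs_cod : nbhs y (chart_cod e).
  exact: open_nbhs_nbhs (conj (@chart_cod_open _ _ _ e) ey).
pose F z := f (chart_inv e z).
have Fy : F y = f x by rewrite /F chart_funK//; exact: chart_at_dom.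
pose W i z := (volume_density e z)%:C * grad f e z 0 i.
have vol0 : (volume_density e y)%:C != 0.
  rewrite (inj_eq (@complexI _) _ 0) gt_eqF// sqrtr_gt0.
  exact: metric_det_gt0.
have step i : cpartial i (fun z => (volume_density e z)%:C *
    grad (fun x => f x ^+ k) e z 0 i) y =
  k%:R * F y ^+ k.-1 * cpartial i (W i) y +
  (k * k.-1)%:R * F y ^+ k.-2 * cpartial i F y * W i y.
  rewrite (@near_eq_cpartial _ _ i y _
    (fun z => F z ^+ k.-1 * (k%:R * W i z))); last first.
    apply: filterS nbhs_cod => z ez.
    by rewrite (grad_expr hf)// mxE /W -/(F z); ring.
  have dF : cderivable i y F by exact: cderivable_chart.
  have dW : cderivable i y (W i) by exact: cderivable_flux.
  have dk := cderivable_cst i y k%:R.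
  rewrite (cpartialM (cderivableX _ dF) (cderivableM dk dW)).
  rewrite (cpartialX _ dF) (cpartialM dk dW) cpartial_cst.
  by rewrite natrM; ring.
transitivity ((volume_density e y)%:C^-1 * \sum_i
    (k%:R * F y ^+ k.-1 * cpartial i (W i) y +
    (k * k.-1)%:R * F y ^+ k.-2 * cpartial i F y * W i y)).
  by congr (_ * _); apply: eq_bigr => i _; exact: step.
rewrite big_split/= -Fy mulrDr; congr (_ + _).
  by rewrite -mulr_sumr mulrCA.
rewrite !mulr_sumr; apply: eq_bigr => i _.
by rewrite /W; field.
Qed.

End AtPoint.

Theorem proposition2p1 (R : realType) (n : nat) (M : riemannian_manifold R n)
  (f : M -> R[i]) (hf : smooth_function f) :
  [<-> lambda_mu_eigenfunction f;
       tau_eigenfunction f /\ tau_eigenfunction (fun x => f x ^+ 2);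
       forall k : nat, (0 < k)%N -> tau_eigenfunction (fun x => f x ^+ k)].
Proof.
have lambda_mu_expr k : lambda_mu_eigenfunction f ->
    tau_eigenfunction (fun x => f x ^+ k).
  move=> [lambda [mu [tauf kappaf]]].
  exists (k%:R * lambda + (k * k.-1)%:R * mu) => x.
  rewrite laplace_beltrami_expr// tauf kappaf natrM.
  (* For k <= 1 the exponents k - 1 or k - 2 are truncated, but their
     coefficients vanish. *)
  by case: k => [|[|k]] /=; rewrite ?exprS; ring.
have lambda_mu_of_square : tau_eigenfunction f ->
    tau_eigenfunction (fun x => f x ^+ 2) -> lambda_mu_eigenfunction f.
  move=> [lambda tauf] [c tauf2]; exists lambda, ((c - 2 * lambda) / 2).
  split=> // x; have := tauf2 x.
  rewrite laplace_beltrami_expr//= tauf => /(canRL (addKr _)) E.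
  have -> : conformality f f x = (2 * 1)%:R * f x ^+ 0 * conformality f f x / 2.
    by field.
  by rewrite E; field.
have f1 : (fun x => f x ^+ 1) = f by apply/funext => x; rewrite expr1.
tfae.
- move=> fE; split; last exact: lambda_mu_expr.
  by rewrite -f1; exact: lambda_mu_expr.
- by move=> [tauf tauf2] k _; apply: lambda_mu_expr; exact: lambda_mu_of_square.
- by move=> fE; apply: lambda_mu_of_square; [rewrite -f1|]; exact: fE.
Qed.
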